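(* Let $K$ be a number field of degree $n$ over $\mathbb{Q}$, let $\Delta(u_1,\dots,u_n)$ be the primitive form whose square is the discriminant of the fundamental equation of $K$ freed from its numerical factor, and let $p$ be a rational prime. If $P_k$ is the first divisor system in the sequence $P_1,P_2,P_3,\dots$ that is not contained in $\Delta(u_1,\dots,u_n)$, then the smallest degree of a supplementary domain $\Gamma$ for $K$ with respect to $p$ is $k$. Moreover, such a supplementary domain of degree $k$ is defined by every polynomial equation $\zeta^k+a_1\zeta^{k-1}+\cdots+a_k=0$ of degree $k$ with integer coefficients whose left side is irreducible modulo $p$ (that is, $\Gamma=\mathbb{Q}(\zeta)$ with $\zeta$ a root of the equation).
   Context: Let $\xi_1,\dots,\xi_n$ be an integral basis of the ring of integers of $K$, $u_1,\dots,u_n$ indeterminates, $w_0=u_1\xi_1+\cdots+u_n\xi_n$ the fundamental form and $w_0,\dots,w_{n-1}$ its conjugates (replace the $\xi_i$ by their conjugates under the $n$ embeddings of $K$). The discriminant of the fundamental equation $\prod_j(w-w_j)=0$ is $\Delta(u_1,\dots,u_n)^2\cdot D$, where $D$ is the discriminant of $K$ (the numerical factor) and $\Delta$ is a homogeneous polynomial of degree $\frac{n(n-1)}2$ with integer coefficients having no common divisor (defined up to sign). For a number field $\Gamma$ with ring of integers $\mathcal{O}_\Gamma$, $\Gamma$ is a supplementary domain for $K$ with respect to the prime $p$ if values $a_1,\dots,a_n\in\mathcal{O}_\Gamma$ can be chosen for $u_1,\dots,u_n$ so that the discriminant $\Delta(a_1,\dots,a_n)^2D$ contains $p$ no more than the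 discriminant $D$ of $K$ does; equivalently, so that $\Delta(a_1,\dots,a_n)$ is coprime to $p$ in $\mathcal{O}_\Gamma$ (lies in no prime ideal dividing $p$). For $k\ge1$, $P_k=(p;\,u_1^{p^k}-u_1,\dots,u_n^{p^k}-u_n)$. The divisor system $P_k$ is contained in a polynomial of $\mathbb{Z}[u_1,\dots,u_n]$ (the polynomial contains $P_k$) if the polynomial lies in the ideal of $\mathbb{Z}[u_1,\dots,u_n]$ generated by $p,\,u_1^{p^k}-u_1,\dots,u_n^{p^k}-u_n$. *)

(* Defs.v *)
From HB Require Import structures.
From mathcomp Require Import all_boot all_order all_fingroup all_algebra all_field.
From mathcomp Require Import boolp.
From mathcomp Require Import mpoly.

Set Implicit Arguments.
Unset Strict Implicit.
Unset Printing Implicit Defensive.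

Import Order.TTheory GRing.Theory Num.Theory.

Local Open Scope ring_scope.

(* A number field is a [fieldExtType rat]; its degree is [\dim {: L}]. *)

Section RingOfIntegers.
Variable L : fieldExtType rat.

Definition integral_elt : {pred L} :=
  fun x => `[< integralOver (intr : int -> L) x >].

Lemma integral_elt_subring : subring_closed integral_elt.
Proof.
split=> [|x y|x y].
- by apply/asboolP; exact: integral1.
- by move=> /asboolP hx /asboolP hy; apply/asboolP; exact: integral_sub.
- by move=> /asboolP hx /asboolP hy; apply/asboolP; exact: integral_mul.
Qed.

HB.instance Definition _ :=
  GRing.isSubringClosed.Build L integral_elt integral_elt_subring.

Record ringOfIntegers :=
  RingOfIntegers { oi_val : L; _ : oi_val \in integral_elt }.

HB.instance Definition _ := [isSub for oi_val].
HB.instance Definition _ := [Choice of ringOfIntegers by <:].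
HB.instance Definition _ := [SubChoice_isSubComNzRing of ringOfIntegers by <:].

End RingOfIntegers.

Definition integral_basis (K : fieldExtType rat) (n : nat) (xi : 'I_n -> ringOfIntegers K) : Prop :=
  forall x : ringOfIntegers K, exists! c : {ffun 'I_n -> int}, x = \sum_i xi i *~ c i.

Section FundamentalForm.
Variables (K : fieldExtType rat) (n : nat).
Variables (xi : 'I_n -> ringOfIntegers K) (sigma : 'I_n -> {rmorphism K -> algC}).

Definition conj_fund_form (j : 'I_n) : {mpoly algC[n]} :=
  \sum_i sigma j (val (xi i)) *: 'X_i.

(* The discriminant of prod_j (w - w_j), expressed through its roots w_j. *)
Definition fund_disc : {mpoly algC[n]} :=
  \prod_(i < n) \prod_(j < n | (i < j)%N)
     (conj_fund_form i - conj_fund_form j) ^+ 2.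

Definition field_disc : algC := (\det (\matrix_(j, i) sigma j (val (xi i)))) ^+ 2.

(* Delta is determined up to sign by these conditions. *)
Definition is_primitive_form (Delta : {mpoly int[n]}) : Prop :=
  [/\ Delta \is ((n * n.-1)./2).-homog,
      forall d : int, (forall m, (d %| Delta@_m)%Z) -> d \is a GRing.unit
    & fund_disc = field_disc *: (map_mpoly (intr : int -> algC) Delta) ^+ 2].

End FundamentalForm.

(* "F contains P_k": F lies in the ideal of Z[u_1, ..., u_n] generated by p and
   the u_i^(p^k) - u_i, i.e. P_k divides F in the sense of divisor systems. *)
Definition contains_divisor_system (n p k : nat) (F : {mpoly int[n]}) : Prop :=
  exists (g : {mpoly int[n]}) (h : 'I_n -> {mpoly int[n]}),
    F = p%:R * g + \sum_i ('X_i ^+ (p ^ k) - 'X_i) * h i.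

(* Delta(a_1, ..., a_n) is coprime to p: it lies in no prime ideal containing p.
   A [prime_idealr] is a proper prime ideal given by a boolean predicate, which
   classically is no restriction. *)
Definition supplementary_domain (n : nat) (Delta : {mpoly int[n]}) (p : nat)
    (G : fieldExtType rat) : Prop :=
  exists a : 'I_n -> ringOfIntegers G, forall P : prime_idealr (ringOfIntegers G),
    p%:R \in P -> (map_mpoly (intr : int -> ringOfIntegers G) Delta).@[a] \notin P.

(* Main.v *)
Require Import Defs.
From HB Require Import structures.
From mathcomp Require Import all_boot all_order all_fingroup all_algebra all_field.
From mathcomp Require Import boolp.
From mathcomp Require Import mpoly.
From mathcomp Require Import cyclic zify ring.

Set Implicit Arguments.
Unset Strict Implicit.
Unset Printing Implicit Defensive.

Import Order.TTheory GRing.Theory Num.Theory.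

Local Open Scope ring_scope.

(** Everything is a statement about the reduction of Delta modulo p.

    Over a field F with q = p^k elements the polynomials X_i^q - X_i vanish
    everywhere, and conversely an integral form that vanishes on all of F^n
    lies in the ideal (p; X_i^q - X_i) ([vanishing_divisor_system]): reduce all
    exponents below q modulo the X_i^q - X_i; the remaining coefficients are
    values of a linear functional of the function on F^n, hence vanish in F,
    hence are divisible by p.  So Delta does not contain P_k exactly when it
    takes a nonzero value on F^n.

    Lower bound ([supplementary_domain_degree_ge]).  The ring of integers of a
    field G of degree d has a prime ideal P containing p whose residue field
    has p^f elements with 1 <= f <= d, so that a^(p^f) - a lies in P for every
    integer a of G.  Here f is the largest number of integers of G independent
    modulo P; it is at most d because any d + 1 elements of G satisfy an
    integral linear relation that is nontrivial modulo p.  If f < k then Delta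
    lies in (p; X_i^(p^f) - X_i), and all its values on integers of G lie in P.

    Upper bound ([supplementary_domain_of_irreducible]).  If f has degree k and
    is irreducible modulo p, then F_p[X]/(f) has p^k elements, and Delta is
    nonzero at some point, which lifts to polynomials b_i in Z[X].  Thus
    Delta(b) is prime to f modulo p; a Bezout relation
    u f + v Delta(b) = 1 + p w, evaluated at the root zeta of f, shows that
    Delta(b(zeta)) lies in no prime ideal containing p.  By Gauss's lemma f is
    irreducible over Q, so Q(zeta) has degree k; and such f exist, being lifts
    of the minimal polynomial of a generator of the multiplicative group of
    the field with p^k elements. *)

(** * Ideals and divisor systems *)

(** Unlike [idealr], this covers improper ideals and ideals given by a
    proposition, such as the divisor systems. *)
Definition Prop_ideal (R : comNzRingType) (I : R -> Prop) :=
  [/\ I 0, forall x y, I x -> I y -> I (x + y) & forall a x, I x -> I (a * x)].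

Section PropIdeal.
Variables (R : comNzRingType) (I : R -> Prop).
Hypothesis idI : Prop_ideal I.

Lemma ideal_sum (T : Type) (s : seq T) (Q : pred T) (F : T -> R) :
  (forall t, Q t -> I (F t)) -> I (\sum_(t <- s | Q t) F t).
Proof. by case: idI => I0 ID _; apply: big_ind. Qed.

Lemma ideal_prod_congr (T : Type) (s : seq T) (Q : pred T) (F G : T -> R) :
  (forall t, Q t -> I (F t - G t)) ->
  I (\prod_(t <- s | Q t) F t - \prod_(t <- s | Q t) G t).
Proof.
case: idI => I0 ID IM FG; apply: (big_rec2 (fun a b => I (a - b))).
  by rewrite subrr.
move=> t a b /FG It Iab.
have -> : F t * a - G t * b = a * (F t - G t) + G t * (a - b) by ring.
by apply: ID; apply: IM.
Qed.

End PropIdeal.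

Lemma divisor_system_ideal (n p k : nat) :
  Prop_ideal (@contains_divisor_system n p k).
Proof.
split=> [|F1 F2 [g1 [h1 ->]] [g2 [h2 ->]]|a F [g [h ->]]].
- exists 0, (fun=> 0); rewrite mulr0 big1 ?addr0 // => i _.
  by rewrite mulr0.
- exists (g1 + g2), (fun i => h1 i + h2 i).
  rewrite mulrDr addrACA -big_split /=; congr (_ + _); apply: eq_bigr => i _.
  by rewrite mulrDr.
exists (a * g), (fun i => a * h i).
rewrite mulrDr mulrCA mulr_sumr; congr (_ + _); apply: eq_bigr => i _.
by rewrite mulrCA.
Qed.

Lemma divisor_system_p (n p k : nat) (F : {mpoly int[n]}) :
  contains_divisor_system p k (p%:R * F).
Proof.
exists F, (fun=> 0); rewrite big1 ?addr0 // => i _; by rewrite mulr0.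
Qed.

Lemma divisor_system_var (n p k : nat) (i : 'I_n) :
  @contains_divisor_system n p k ('X_i ^+ (p ^ k) - 'X_i).
Proof.
exists 0, (fun j => (j == i)%:R); rewrite mulr0 add0r (bigD1 i) //= eqxx mulr1.
by rewrite big1 ?addr0 // => j /negPf ->; rewrite mulr0.
Qed.

(** * Forms vanishing over a finite field *)

(** The congruence is stated in Z[X] because it is used twice: evaluated at
    the variables it is a congruence modulo the divisor system, evaluated in
    the field with q elements it is an equality of values. *)
Lemma reduce_exponent (q e : nat) : (1 < q)%N ->
  exists r : 'I_q, exists h : {poly int},
    'X^e = 'X^r + ('X^q - 'X) * h :> {poly int}.
Proof.
move=> q1; elim/ltn_ind: e => e IH.
have [lt_eq|le_qe] := ltnP e q.
  by exists (Ordinal lt_eq), 0; rewrite mulr0 addr0.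
have [|r [h Dr]] := IH (e - q).+1; first by lia.
exists r, ('X^(e - q) + h); rewrite mulrDr addrCA -Dr mulrBl -exprD -exprS.
by rewrite subnKC // subrK.
Qed.

(** The weight w j y is the coefficient of X^j in the Lagrange polynomial
    1 - (X - y)^(q - 1), which is 1 at y and 0 at the other points of F: the
    polynomial X^i is interpolated by its values. *)
Lemma monomial_dual_weights (F : finFieldType) :
  exists w : 'I_#|F| -> F -> F,
    forall i j : 'I_#|F|, \sum_y w j y * y ^+ i = (i == j)%:R.
Proof.
set q := #|F|; have q1 : (1 < q)%N by apply: finNzRing_gt1.
pose L (y : F) : {poly F} := 1 - ('X - y%:P) ^+ q.-1.
have Leval y z : (L y).[z] = (z == y)%:R.
  rewrite /L !hornerE -subr_eq0; have [->|nz] := eqVneq (z - y) 0.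
    by rewrite expr0n (gtn_eqF (_ : 0 < q.-1)%N) ?subr0 //; lia.
  apply/eqP; rewrite subr_eq0 eq_sym; apply/eqP/(mulfI nz).
  by rewrite -exprS prednK ?mulr1 ?expf_card //; lia.
have sizeL y : (size (L y) <= q)%N.
  rewrite (leq_trans (size_polyD _ _)) // size_polyN size_poly1 size_exp_XsubC.
  by rewrite geq_max; lia.
exists (fun j y => (L y)`_j) => i j.
suff -> : (i == j)%:R = ('X^i : {poly F})`_j.
  have -> : 'X^i = \sum_y y ^+ i *: L y.
    apply/eqP; rewrite -subr_eq0; apply/eqP.
    apply: (@roots_geq_poly_eq0 _ _ (enum F)).
    - apply/allP => z _; rewrite /root !hornerE horner_sum (bigD1 z) //=.
      rewrite hornerZ Leval eqxx mulr1 big1 ?addr0 ?subrr // => y.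
      by rewrite hornerZ Leval eq_sym => /negPf->; rewrite mulr0.
    - exact: enum_uniq.
    rewrite -cardE -/q (leq_trans (size_polyD _ _)) // size_polyN geq_max.
    rewrite size_polyXn ltn_ord (leq_trans (size_sum _ _ _)) //.
    by apply/bigmax_leqP => y _; rewrite (leq_trans (size_scale_leq _ _)).
  by rewrite coef_sum; apply: eq_bigr => y _; rewrite coefZ mulrC.
by rewrite coefXn eq_sym.
Qed.

(** A product of dual weights over the coordinates extracts one coefficient
    from the values of the form, by distributivity. *)
Lemma reduced_form_coef0 (F : finFieldType) (n : nat)
    (c : {ffun 'I_n -> 'I_#|F|} -> F) :
  (forall x : {ffun 'I_n -> F}, \sum_s c s * \prod_i x i ^+ s i = 0) ->
  forall s, c s = 0.
Proof.
move=> c0 t; have [w Dw] := monomial_dual_weights F.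
have: \sum_(x : {ffun 'I_n -> F}) (\prod_i w (t i) (x i)) *
        \sum_s c s * \prod_i x i ^+ s i = 0.
  by rewrite big1 // => x _; rewrite c0 mulr0.
under eq_bigr do rewrite mulr_sumr.
rewrite exchange_big /= (bigD1 t) //= [X in _ + X]big1 => [|s ne_st].
  rewrite addr0 => <-; under eq_bigr do rewrite mulrCA -big_split /=.
  rewrite -mulr_sumr -(bigA_distr_bigA (fun i y => w (t i) y * y ^+ t i)).
  by rewrite big1 ?mulr1 // => i _; rewrite Dw eqxx.
under eq_bigr do rewrite mulrCA -big_split /=.
rewrite -mulr_sumr -(bigA_distr_bigA (fun i y => w (t i) y * y ^+ s i)).
have [i ne_i] : exists i, s i != t i.
  apply/existsP; apply: contraNT ne_st => /existsPn eq_st.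
  by apply/eqP/ffunP => i; apply/eqP/negPn/eq_st.
by rewrite (bigD1 i) //= Dw (negPf ne_i) mul0r mulr0.
Qed.

Lemma pchar_dvdz (F : fieldType) (p : nat) (c : int) :
  p \in [pchar F] -> c%:~R = 0 :> F -> (p %| c)%Z.
Proof.
move=> pF /eqP; rewrite dvdzE (dvdn_pcharf pF); case: c => m //=.
by rewrite NegzE mulrNz oppr_eq0.
Qed.

Lemma meval_map_mpoly (R S : comNzRingType) (f : {rmorphism R -> S}) (n : nat)
    (D : {mpoly R[n]}) (x : 'I_n -> S) :
  (map_mpoly f D).@[x] = \sum_(m <- msupp D) f D@_m * \prod_i x i ^+ m i.
Proof.
pose g (m : 'X_{1..n}) := D@_m *: 'X_[m].
transitivity (map_mpoly f (\sum_(m <- msupp D) g m)).@[x].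
  by rewrite -mpolyE.
rewrite (raddf_sum (map_mpoly f)) (raddf_sum (meval x)); apply: eq_bigr => m _.
by rewrite /= map_mpolyZ map_mpolyX mevalZ mevalX.
Qed.

(** Replace each monomial of D by its reduction and collect equal reductions:
    the collected coefficients c s vanish in F. *)
Lemma vanishing_divisor_system (F : finFieldType) (n p k : nat)
    (D : {mpoly int[n]}) :
  p \in [pchar F] -> #|F| = (p ^ k)%N ->
  (forall x : 'I_n -> F, (map_mpoly (intr : int -> F) D).@[x] = 0) ->
  contains_divisor_system p k D.
Proof.
move=> pF cardF D0; set q := #|F|; have q1 : (1 < q)%N by apply: finNzRing_gt1.
have [I0 ID IM] := divisor_system_ideal n p k.
have [r] := choice (fun e => reduce_exponent e q1).
case/choice => h Dr.
pose red (m : 'X_{1..n}) : {ffun 'I_n -> 'I_q} := [ffun i => r (m i)].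
pose mon (s : {ffun 'I_n -> 'I_q}) : {mpoly int[n]} := \prod_i 'X_i ^+ s i.
pose c s : int := \sum_(m <- msupp D | red m == s) D@_m.
have c_p s : (p %| c s)%Z.
  apply: (pchar_dvdz pF); move: s; apply: reduced_form_coef0 => x.
  have sum0 : \sum_(m <- msupp D) (D@_m)%:~R * \prod_i x i ^+ m i = 0 :> F.
    by rewrite -[RHS](D0 x) (meval_map_mpoly intr).
  rewrite -[RHS]sum0 [RHS](partition_big red xpredT) //=; apply: eq_bigr => s _.
  rewrite rmorph_sum mulr_suml /=; apply: eq_bigr => m /eqP <-; congr (_ * _).
  apply: eq_bigr => i _; rewrite ffunE.
  have /(congr1 (fun g : {poly int} => (map_poly intr g).[x i])) := Dr (m i).
  rewrite rmorphD rmorphM rmorphB /= !map_polyXn map_polyX !hornerE.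
  by rewrite expf_card subrr mul0r addr0.
have mon_red m : contains_divisor_system p k ('X_[m] - mon (red m)).
  rewrite mpolyXE_id; apply: ideal_prod_congr => [|i _].
    exact: divisor_system_ideal.
  rewrite ffunE.
  pose ev (g : {poly int}) : {mpoly int[n]} :=
    (map_poly (mpolyC n (R:=int)) g).['X_i].
  have /(congr1 ev) := Dr (m i).
  rewrite /ev rmorphD rmorphM rmorphB /= !map_polyXn map_polyX !hornerE => ->.
  by rewrite addrC addKr mulrC /q cardF; apply/IM/divisor_system_var.
(* The first sum consists of exponent reductions, the second of multiples of p. *)
have -> : D = \sum_(m <- msupp D) (D@_m)%:MP * ('X_[m] - mon (red m))
              + \sum_s (c s)%:MP * mon s.
  rewrite {1}(mpolyE D).
  have -> : \sum_s (c s)%:MP * mon s =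
      \sum_(m <- msupp D) (D@_m)%:MP * mon (red m).
    rewrite [RHS](partition_big red xpredT) //=; apply: eq_bigr => s _.
    by rewrite rmorph_sum mulr_suml /=; apply: eq_bigr => m /eqP <-.
  rewrite -big_split /=; apply: eq_bigr => m _.
  by rewrite -mulrDr subrK mul_mpolyC.
apply: ID; apply: (ideal_sum (divisor_system_ideal n p k)) => s _.
  exact: IM.
have /dvdzP[d ->] := c_p s; rewrite [d * _]mulrC rmorphM -mulrA -natz rmorph_nat.
exact: divisor_system_p.
Qed.

(** * Prime ideals over p and their residue degree *)

Definition pred_of_Prop (T : Type) (S : T -> Prop) : {pred T} :=
  fun x => `[< S x >].

Lemma pred_of_PropP (T : Type) (S : T -> Prop) (x : T) :
  reflect (S x) (x \in pred_of_Prop S).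
Proof. exact: asboolP. Qed.

Definition adjoin_ideal (R : comNzRingType) (I : {pred R}) (x : R) : {pred R} :=
  pred_of_Prop (fun z => exists y a, y \in I /\ z = y + a * x).

Section ResidueRank.
Variables (R : comNzRingType) (p : nat).
Hypothesis p_pr : prime p.

(** When p belongs to the ideal I, this is linear independence over F_p of the
    classes of the v i in R / I; the largest possible m is the residue rank
    of I. *)
Definition indep_mod (I : {pred R}) (m : nat) (v : 'I_m -> R) :=
  forall c : 'I_m -> int, \sum_i v i *~ c i \in I -> forall i, (p %| c i)%Z.

Lemma bezout_mod_prime (c : int) : ~~ (p %| c)%Z ->
  exists u w : int, u * c + w * p = 1.
Proof.
move=> pNc; have /coprimezP[[u w] /= Duw] : coprimez c p.
  by rewrite coprimezE coprime_sym prime_coprime.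
by exists u, w.
Qed.

Lemma idealr_closed_Prop (I : {pred R}) :
  idealr_closed I -> Prop_ideal (fun x => x \in I).
Proof.
case=> I0 _ Ilin; split=> // [x y Ix Iy|a x Ix].
  by rewrite -[x]mul1r Ilin.
by rewrite -[_ * _]addr0 Ilin.
Qed.

Lemma mem_idealrMz (I : {pred R}) (x : R) (c : int) :
  idealr_closed I -> p%:R \in I -> (p %| c)%Z -> x *~ c \in I.
Proof.
move=> /idealr_closed_Prop[_ _ IM] Ip /dvdzP[d ->].
by rewrite -mulrzl intrM mulrAC; apply: IM.
Qed.

Section Ideal.
Variable I : {pred R}.
Hypotheses (idI : idealr_closed I) (Ip : p%:R \in I).

Let I0 : 0 \in I. Proof. by case: (idealr_closed_Prop idI). Qed.
Let ID x y : x \in I -> y \in I -> x + y \in I.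
Proof. by case: (idealr_closed_Prop idI) => _ + _; apply. Qed.
Let IM a x : x \in I -> a * x \in I.
Proof. by case: (idealr_closed_Prop idI) => _ _; apply. Qed.
Let IN x : x \in I -> - x \in I.
Proof. by rewrite -mulN1r; apply: IM. Qed.

Lemma sum_mulrz_recl m (v : 'I_m -> R) x (c : 'I_m.+1 -> int) :
  \sum_i oapp v x (unlift ord0 i) *~ c i =
  x *~ c ord0 + \sum_i v i *~ c (lift ord0 i).
Proof.
rewrite big_ord_recl unlift_none; congr (_ + _).
by apply: eq_bigr => i _; rewrite liftK.
Qed.

(** A relation among x and the v i modulo I is a relation among the v i modulo
    J, so p divides the coefficients of the v i; the coefficient of x is then
    divisible by p too, since otherwise Bezout would put x in I.  Hence the
    residue rank strictly decreases when the ideal grows. *)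
Lemma indep_mod_extend (J : {pred R}) m (v : 'I_m -> R) x :
    idealr_closed J -> {subset I <= J} -> x \in J -> x \notin I ->
  indep_mod J v -> indep_mod I (fun i : 'I_m.+1 => oapp v x (unlift ord0 i)).
Proof.
move=> idJ sIJ Jx nIx indJ c; rewrite sum_mulrz_recl => Ic.
have [J0 JD JM] := idealr_closed_Prop idJ.
have cv i : (p %| c (lift ord0 i))%Z.
  apply: (indJ (fun i => c (lift ord0 i))).
  rewrite -[X in X \in J](addKr (x *~ c ord0)).
  by apply: JD; [rewrite -mulrNz -mulrzl; apply: JM | apply: sIJ].
have c0 : (p %| c ord0)%Z.
  apply: contraR nIx => /bezout_mod_prime[u [w Duw]].
  have Icx : x *~ c ord0 \in I.
    rewrite -[X in X \in I](addrK (\sum_i v i *~ c (lift ord0 i))) ID // IN //.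
    by apply: (ideal_sum (idealr_closed_Prop idI)) => i _; apply: mem_idealrMz.
  rewrite -[x]mulr1z -Duw mulrzDr ID //; last first.
    by apply: mem_idealrMz => //; apply: dvdz_mull.
  by rewrite mulrC mulrzA -mulrzl IM.
by move=> i; case: (unliftP ord0 i) => [j|] ->.
Qed.

Lemma indep_mod_one : 1 \notin I -> indep_mod I (fun _ : 'I_1 => 1).
Proof.
move=> nI1 c; rewrite big_ord1 => Ic i; rewrite [i]ord1.
apply: contraR nI1 => /bezout_mod_prime[u [w Duw]].
rewrite -[1]mulr1z -Duw mulrzDr ID //; last first.
  by apply: mem_idealrMz => //; apply: dvdz_mull.
by rewrite mulrC mulrzA -mulrzl IM.
Qed.

End Ideal.

Lemma idealr_closed_adjoin (I : {pred R}) (x : R) :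
  idealr_closed I -> 1 \notin adjoin_ideal I x -> idealr_closed (adjoin_ideal I x).
Proof.
move=> idI nJ1; have [I0 ID IM] := idealr_closed_Prop idI; split=> //.
  by apply/pred_of_PropP; exists 0, 0; rewrite mul0r addr0.
move=> b z1 z2 /pred_of_PropP[y1 [a1 [Iy1 ->]]] /pred_of_PropP[y2 [a2 [Iy2 ->]]].
apply/pred_of_PropP; exists (b * y1 + y2), (b * a1 + a2); split; last by ring.
by apply: ID => //; apply: IM.
Qed.

Lemma maximal_idealr_closed_prime (I : {pred R}) :
    idealr_closed I ->
    (forall x, x \notin I -> 1 \in adjoin_ideal I x) ->
  prime_idealr_closed I.
Proof.
move=> idI maxI u v Iuv; have [I0 ID IM] := idealr_closed_Prop idI.
have [//|/maxI/pred_of_PropP[y [a [Iy D1]]]] := boolP (u \in I).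
rewrite -[v]mul1r D1 mulrDl [y * v]mulrC -mulrA /=; apply: ID; exact: IM.
Qed.

(** Among the proper ideals containing p take one whose residue rank f is
    minimal; p R itself has rank at most d.  By [indep_mod_extend] an element
    outside this ideal cannot be adjoined without reaching 1, so the ideal is
    maximal and therefore prime. *)
Lemma exists_prime_of_rank (d : nat) :
    (forall m (v : 'I_m -> R), (d < m)%N ->
       exists2 c : 'I_m -> int,
         \sum_i v i *~ c i = 0 & exists i, ~~ (p %| c i)%Z) ->
    (forall x : R, p%:R * x != 1) ->
  exists (P : prime_idealr R) (f : nat) (v : 'I_f -> R),
    [/\ p%:R \in P, (0 < f <= d)%N, indep_mod P v &
        forall w : 'I_f.+1 -> R, ~ indep_mod P w].
Proof.
move=> Hd pNunit.
pose Q m := exists I : {pred R}, [/\ idealr_closed I, p%:R \in I &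
   forall w : 'I_m -> R, ~ indep_mod I w].
have Qd : `[< Q d.+1 >].
  apply/asboolP.
  exists (pred_of_Prop (fun z => exists x, z = p%:R * x)); split.
  - split=> [||b z1 z2].
    + by apply/pred_of_PropP; exists 0; rewrite mulr0.
    + by apply/pred_of_PropP => -[x Dx]; case/eqP: (pNunit x).
    move=> /pred_of_PropP[x1 ->] /pred_of_PropP[x2 ->]; apply/pred_of_PropP.
    by exists (b * x1 + x2); ring.
  - by apply/pred_of_PropP; exists 1; rewrite mulr1.
  move=> w indw; have [//|c Dc [i /negP]] := Hd _ w; apply; apply: indw.
  by rewrite Dc; apply/pred_of_PropP; exists 0; rewrite mulr0.
(* The least size at which an ideal has no independent family is one more than
   the least residue rank. *)
have [[|f] /asboolP[I [idI Ip nindI]] min_f] :=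
    ex_minnP (ex_intro (fun m => `[< Q m >]) _ Qd).
  by case: (nindI (fun=> 0)) => c _ [].
have f_gt0 : (0 < f)%N.
  case: f nindI {min_f} => // nindI; case: (nindI (fun=> 1)).
  by apply: indep_mod_one => //; case: idI.
have leJ (J : {pred R}) : idealr_closed J -> p%:R \in J ->
    exists v : 'I_f -> R, indep_mod J v.
  move=> idJ Jp; apply: contrapT => /forallNP nind.
  by have := min_f f; rewrite ltnn => nQ; apply/notF/nQ; apply/asboolP; exists J.
have maxI x : x \notin I -> 1 \in adjoin_ideal I x.
  move=> nIx; have [I0 ID IM] := idealr_closed_Prop idI.
  set J := adjoin_ideal I x; apply: contraT => nJ1.
  have idJ : idealr_closed J by apply: idealr_closed_adjoin.
  have sIJ : {subset I <= J}.
    move=> z Iz; apply/pred_of_PropP.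
    by exists z, 0; rewrite mul0r addr0.
  have Jx : x \in J.
    by apply/pred_of_PropP; exists 0, 1; rewrite mul1r add0r.
  have [v indv] := leJ J idJ (sIJ _ Ip).
  by case: (nindI _ (indep_mod_extend idI Ip idJ sIJ Jx nIx indv)).
have prI := maximal_idealr_closed_prime idI maxI.
pose P : prime_idealr R := HB.pack_for (prime_idealr R) (I : R -> bool)
  (isIdealr.Build R I idI) (isPrimeIdealrClosed.Build R I prI).
have [v indv] := leJ I idI Ip.
exists P, f, v; split=> //.
by rewrite f_gt0 -ltnS; apply: min_f.
Qed.

(** The combinations lc c with coefficients in 0, ..., p - 1 represent every
    class modulo P exactly once, so R / P has p^f elements.  As in Fermat's
    theorem, multiplication by x outside P permutes the nonzero classes, and
    comparing the products of their representatives gives x^(p^f - 1) = 1. *)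
Lemma frobenius_mod_prime (P : prime_idealr R) (f : nat) (v : 'I_f -> R) :
    p%:R \in P -> indep_mod P v -> (forall w : 'I_f.+1 -> R, ~ indep_mod P w) ->
  forall x, x ^+ (p ^ f) - x \in P.
Proof.
move=> Pp indv maxv.
have idP : idealr_closed P.
  split; [exact: idealr0 | by rewrite idealr1 | move=> a x y Px Py].
  by rewrite rpredD ?idealMr.
have addP := idealr_closed_Prop idP.
pose T := {ffun 'I_f -> 'I_p}; pose lc (c : T) : R := \sum_i v i *+ c i.
have lc_inj c1 c2 : lc c1 - lc c2 \in P -> c1 = c2.
  move=> Pc; apply/ffunP => i; apply/val_inj => /=.
  have := indv (fun i => (c1 i)%:Z - (c2 i)%:Z) _ i.
  have -> : \sum_i v i *~ ((c1 i)%:Z - (c2 i)%:Z) = lc c1 - lc c2.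
    by rewrite -sumrB; apply: eq_bigr => j _; rewrite mulrzBr -!pmulrn.
  move=> /(_ Pc) /dvdzP[e /= De].
  have lt1 := ltn_ord (c1 i); have lt2 := ltn_ord (c2 i).
  have [e0|[e1|e1]] : e = 0 \/ 1 <= e \/ e <= -1 by lia.
  - by move: De; rewrite e0; lia.
  - by nia.
  by nia.
have lc_surj x : exists c, x - lc c \in P.
  have /existsNP[e /not_implyP[]] :=
    maxv (fun i : 'I_f.+1 => oapp v x (unlift ord0 i)).
  rewrite sum_mulrz_recl => Pe /existsNP[i0 nei0].
  have ne0 : ~~ (p %| e ord0)%Z.
    apply/negP => e0; apply: nei0; case: (unliftP ord0 i0) => [j|] -> //.
    apply: (indv (fun i => e (lift ord0 i))).
    rewrite -[X in X \in P](addKr (x *~ e ord0)) rpredD ?rpredN //.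
    exact: mem_idealrMz.
  have [u [w Duw]] := bezout_mod_prime ne0.
  have p_gt0 := prime_gt0 p_pr.
  pose c i := (- (u * e (lift ord0 i)) %% p)%Z.
  have cP i : (`|c i| < p)%N.
    by rewrite -ltz_nat gez0_abs ?modz_ge0 ?ltz_pmod //; lia.
  exists [ffun i => Ordinal (cP i)].
  (* The bracket lies in P by Pe, and the two other terms are multiples of p. *)
  have -> : x - lc [ffun i => Ordinal (cP i)] =
      (u%:~R * (x *~ e ord0 + \sum_i v i *~ e (lift ord0 i)) + x *~ (w * p))
      - (\sum_i v i *~ (u * e (lift ord0 i) + c i)).
    have -> : lc [ffun i => Ordinal (cP i)] = \sum_i v i *~ c i.
      apply: eq_bigr => i _; rewrite ffunE /= pmulrn gez0_abs //.
      by apply: modz_ge0; lia.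
    have -> : \sum_i v i *~ (u * e (lift ord0 i) + c i) =
        u%:~R * (\sum_i v i *~ e (lift ord0 i)) + \sum_i v i *~ c i.
      rewrite mulr_sumr -big_split; apply: eq_bigr => i _ /=.
      by rewrite mulrzDr mulrC mulrzA mulrzl mulrzAC.
    have {1}-> : x = u%:~R * (x *~ e ord0) + x *~ (w * p).
      by rewrite mulrzl -mulrzA [e _ * u]mulrC -mulrzDr Duw.
    ring.
  rewrite rpredB ?rpredD ?idealMr //.
    by apply: mem_idealrMz; rewrite ?dvdz_mull.
  apply: rpred_sum => i _; apply: mem_idealrMz => //.
  by apply/dvdz_mod0P; rewrite modzDmr subrr mod0z.
move=> x; have [Px|nPx] := boolP (x \in P).
  rewrite rpredB // -(@prednK (p ^ f)) ?expn_gt0 ?prime_gt0 //.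
  by rewrite exprSr idealMr.
have [phi phiP] := choice lc_surj.
(* c0 is the index of the zero class. *)
pose c0 := phi 0.
have c0P c : (lc c \in P) = (c == c0).
  have Pc0 : lc c0 \in P by rewrite -rpredN -sub0r phiP.
  have [->//|] := eqVneq c c0.
  by apply: contraNF => Pc; apply/eqP/lc_inj/rpredB.
pose pi c := phi (x * lc c).
have pi_inj : injective pi.
  move=> c1 c2 eq_pi; apply: lc_inj.
  have : x * (lc c1 - lc c2) \in P.
    have -> : x * (lc c1 - lc c2) =
        (x * lc c1 - lc (pi c1)) - (x * lc c2 - lc (pi c2)).
      by rewrite eq_pi; ring.
    exact: rpredB.
  by rewrite prime_idealrM (negPf nPx).
have pi_c0 c : (pi c != c0) = (c != c0).
  rewrite -!c0P -[lc (pi c)](subKr (x * lc c)) rpredBr ?phiP //.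
  by rewrite prime_idealrM (negPf nPx).
pose A := \prod_(c | c != c0) lc c.
have nPA : A \notin P.
  apply: (big_ind (fun a => a \notin P)) => [||c]; rewrite ?c0P ?idealr1 //.
  by move=> a b /negPf nPa /negPf nPb; rewrite prime_idealrM nPa nPb.
have DA : A = \prod_(c | c != c0) lc (pi c).
  by rewrite /A (reindex_inj pi_inj); apply: eq_bigl => c; rewrite pi_c0.
have : (x ^+ (p ^ f).-1 - 1) * A \in P.
  rewrite mulrBl mul1r {2}DA.
  have -> : x ^+ (p ^ f).-1 * A = \prod_(c | c != c0) (x * lc c).
    rewrite big_split prodr_const /=; congr (_ ^+ _ * _).
    by rewrite cardC1 card_ffun !card_ord.
  by apply: (ideal_prod_congr addP) => c _.
rewrite prime_idealrM (negPf nPA) orbF => /(idealMr x).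
by rewrite mulrBr mulr1 -exprS prednK // expn_gt0 prime_gt0.
Qed.

End ResidueRank.

(** * The lower bound for the degree *)

(** A rational relation, written as a polynomial, is proportional to a
    primitive integral one. *)
Lemma integral_relation_mod_prime (L : fieldExtType rat) (p m : nat)
    (v : 'I_m -> L) :
    prime p -> (\dim {: L} < m)%N ->
  exists2 c : 'I_m -> int, \sum_i v i *~ c i = 0 & exists i, ~~ (p %| c i)%Z.
Proof.
move=> p_pr dim_m; pose X : m.-tuple L := [tuple v i | i < m].
have nfreeX : ~~ free X.
  apply: contraL dim_m => /eqP dimX; rewrite -leqNgt.
  by rewrite (leq_trans _ (dimvS (subvf <<X>>%VS))) // dimX size_tuple.
have [k k0 [i0 nzk]] : exists2 k : 'I_m -> rat, \sum_i k i *: v i = 0 &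
    exists i, k i != 0.
  apply: contrapT => nk; case/freeP: nfreeX => k k0 i.
  apply: contrapT => /eqP nzk; apply: nk; exists k; last by exists i.
  by rewrite -[RHS]k0; apply: eq_bigr => j _; rewrite -tnth_nth tnth_mktuple.
pose r : {poly rat} := \poly_(i < m) oapp k 0 (insub i).
have rE (i : 'I_m) : r`_i = k i by rewrite coef_poly ltn_ord valK.
have [q [a nz_a Dr]] := rat_poly_scale r.
have nzq : q != 0.
  apply: contraNneq nzk => q0; have := rE i0.
  by rewrite Dr q0 rmorph0 scaler0 coef0 => <-.
pose z := zprimitive q; pose b : rat := a%:~R^-1 * (zcontents q)%:~R.
have nzb : b != 0.
  by rewrite mulf_neq0 ?invr_eq0 ?intr_eq0 ?zcontents_eq0.
have rz i : r`_i = b * (z`_i)%:~R.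
  by rewrite Dr (zpolyEprim q) coefZ coef_map coefZ /= intrM mulrA.
exists (fun i => z`_i).
  apply: (scalerI nzb); rewrite scaler0 -[RHS]k0 scaler_sumr.
  by apply: eq_bigr => i _; rewrite -scaler_int scalerA -rz rE.
apply: contrapT => /forallNP pz.
have : (p %| zcontents z)%Z.
  rewrite dvdz_contents; apply/polyOverP => i.
  have [lt_im|le_mi] := ltnP i m; first exact/negPn/negP/(pz (Ordinal lt_im)).
  have /eqP := rz i; rewrite coef_poly ltnNge le_mi eq_sym mulf_eq0 (negPf nzb).
  by rewrite intr_eq0 => /eqP ->; apply: dvdz0.
by rewrite zcontents_primitive nzq dvdzE dvdn1 /=; move: p_pr; case: eqP => // ->.
Qed.

(** If x = 1/p is a root of a monic polynomial q of degree d, multiplying by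
    p^d leaves 1 plus a multiple of p equal to 0. *)
Lemma prime_not_unit_integers (L : fieldExtType rat) (p : nat)
    (x : ringOfIntegers L) : prime p -> p%:R * x != 1.
Proof.
move=> p_pr; apply/eqP => /(congr1 val); rewrite rmorphM rmorph_nat rmorph1 => px1.
have /asboolP[q q_monic] := valP x.
set y := val x in px1 *; rewrite /root horner_coef size_map_poly_id0; last first.
  by rewrite (eqP q_monic) rmorph1 oner_eq0.
have nzq := monic_neq0 q_monic.
have [d Dd] : exists d, size q = d.+1.
  by move: nzq; rewrite -size_poly_eq0; case: (size q) => // d; exists d.
rewrite Dd big_ord_recr /= !coef_map => /eqP qy0.
have qd : q`_d = 1 by rewrite -(eqP q_monic) lead_coefE Dd.
pose N := \sum_(i < d) q`_i * (p ^ (d - i).-1)%:Z.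
have : (N * p + 1)%:~R = 0 :> L.
  rewrite -[RHS](mulr0 (p%:R ^+ d)) -qy0 qd mulrDr /= mulr1z mul1r -exprMn px1 expr1n.
  rewrite intrD intrM; congr (_ + _); rewrite rmorph_sum mulr_suml mulr_sumr.
  apply: eq_bigr => i _; rewrite coef_map /= intrM.
  have -> : p%:R ^+ d = p%:R ^+ (d - i).-1 * p%:R * p%:R ^+ i :> L.
    by rewrite -exprSr -exprD; congr (_ ^+ _); have := ltn_ord i; lia.
  have pyi : p%:R ^+ i * y ^+ i = 1 by rewrite -exprMn px1 expr1n.
  rewrite -!pmulrn natrX -[LHS]mulr1 -[X in _ * X = _]pyi; ring.
move=> /eqP; rewrite -scaler_int scaler_eq0 oner_eq0 orbF intr_eq0 => /eqP N0.
have : (p %| 1)%Z by apply/dvdzP; exists (- N); lia.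
by rewrite dvdzE dvdn1 /=; move: p_pr; case: eqP => // ->.
Qed.

Lemma contains_divisor_system_eval (R : comNzRingType) (I : R -> Prop)
    (n p k : nat) (D : {mpoly int[n]}) (a : 'I_n -> R) :
    Prop_ideal I -> I p%:R -> (forall i, I (a i ^+ (p ^ k) - a i)) ->
  contains_divisor_system p k D -> I (map_mpoly (intr : int -> R) D).@[a].
Proof.
move=> idI Ip Ia [g [h ->]]; have [I0 ID IM] := idI.
pose ev : {rmorphism {mpoly int[n]} -> R} := meval a \o map_mpoly (intr : int -> R).
rewrite -[_.@[a]]/(ev _) rmorphD rmorphM rmorph_nat mulrC; apply: ID; first exact: IM.
rewrite rmorph_sum; apply: (ideal_sum idI) => i _; rewrite rmorphM mulrC.
apply: IM; rewrite rmorphB rmorphXn.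
have -> : ev 'X_i = a i by rewrite /ev /= map_mpolyX mevalXU.
exact: Ia.
Qed.

Lemma supplementary_domain_degree_ge (G : fieldExtType rat) (n p k : nat)
    (D : {mpoly int[n]}) :
    prime p -> (forall j, (0 < j < k)%N -> contains_divisor_system p j D) ->
  supplementary_domain D p G -> (k <= \dim {: G})%N.
Proof.
move=> p_pr Dj [a aP]; rewrite leqNgt; apply/negP => lt_k.
have [||P [f [v [Pp /andP[f0 fd] indv maxv]]]] :=
    @exists_prime_of_rank (ringOfIntegers G) p p_pr (\dim {: G}).
- move=> m v /(integral_relation_mod_prime (fun i => val (v i)) p_pr)[c c0 nc].
  exists c => //; apply: val_inj; rewrite rmorph0 -[RHS]c0 rmorph_sum.
  by apply: eq_bigr => i _; rewrite rmorphMz.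
- by move=> x; apply: prime_not_unit_integers.
have frobP := frobenius_mod_prime p_pr Pp indv maxv.
case/negP: (aP P Pp).
apply: (contains_divisor_system_eval (I := fun x => x \in P) (p := p)
          (k := f)) => //.
  by split=> [|x y|b x]; [exact: rpred0 | exact: rpredD | exact: idealMr].
by apply: Dj; rewrite f0 (leq_ltn_trans fd).
Qed.

(** * Polynomials irreducible modulo p *)

Lemma lift_poly_Fp (p : nat) (g : {poly 'F_p}) :
  exists2 h : {poly int}, map_poly intr h = g & size h = size g.
Proof.
pose lift (c : 'F_p) : int := (c : nat)%:Z.
have liftK c : (lift c)%:~R = c :> 'F_p by rewrite -pmulrn natr_Zp.
exists (map_poly lift g).
  rewrite -map_poly_comp_id0 //; apply: map_poly_id => c _ /=; exact: liftK.
by rewrite size_map_inj_poly //; apply: can_inj liftK.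
Qed.

Lemma rmorph_meval_int (R S : comNzRingType) (phi : {rmorphism R -> S}) (n : nat)
    (D : {mpoly int[n]}) (a : 'I_n -> R) :
  phi (map_mpoly (intr : int -> R) D).@[a] =
  (map_mpoly (intr : int -> S) D).@[fun i => phi (a i)].
Proof.
rewrite (meval_map_mpoly intr) (meval_map_mpoly (intr : int -> S)) rmorph_sum.
apply: eq_bigr => m _; rewrite rmorphM rmorph_int rmorph_prod; congr (_ * _).
by apply: eq_bigr => i _; rewrite rmorphXn.
Qed.

Lemma bezout_mod_prime_poly (p : nat) (f g : {poly int}) : prime p ->
    coprimep (map_poly (intr : int -> 'F_p) f) (map_poly intr g) ->
  exists u v w : {poly int}, u * f + v * g = 1 + p%:R * w.
Proof.
move=> p_pr /Bezout_eq1_coprimepP[[u' v']] /=.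
have [u <- _] := lift_poly_Fp u'; have [v <- _] := lift_poly_Fp v'.
rewrite -!rmorphM -rmorphD => Duv; exists u, v.
have pD : u * f + v * g - 1 \is a polyOver (dvdz p).
  apply/polyOverP => i; apply: (@pchar_dvdz 'F_p); first exact: pchar_Fp.
  by rewrite -coef_map rmorphB /= Duv rmorph1 subrr coef0.
exists (map_poly (divz^~ p) (u * f + v * g - 1)).
have pE : p%:R = (p%:Z)%:P :> {poly int} by rewrite -natz rmorph_nat.
by rewrite pE mul_polyC (map_poly_divzK pD) [RHS]addrC subrK.
Qed.

(** The Bezout relation holds in Z[X], so its value at zeta, where f vanishes,
    excludes Delta(b(zeta)) from all the prime ideals over p at once. *)
Lemma supplementary_domain_of_irreducible (n p k : nat) (D : {mpoly int[n]})
    (f : {poly int}) (G : fieldExtType rat) (zeta : G) :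
    prime p -> ~ contains_divisor_system p k D ->
    f \is monic -> size f = k.+1 ->
    irreducible_poly (map_poly (intr : int -> 'F_p) f) ->
    root (map_poly (intr : int -> G) f) zeta ->
  supplementary_domain D p G.
Proof.
move=> p_pr nD f_monic size_f irr_f f_zeta.
set fp := map_poly _ f in irr_f.
have fp_monic : fp \is monic by apply: monic_map.
have hI : monic_irreducible_poly fp by split.
pose F := {poly %/ fp with hI}.
have pcharF : p \in [pchar F] by rewrite pchar_qpoly; apply: pchar_Fp.
have cardF : #|F| = (p ^ k)%N.
  rewrite card_qfpoly card_Fp // size_map_poly_id0 ?size_f //.
  by rewrite (eqP f_monic) rmorph1 oner_eq0.
have [x nDx] : exists x : 'I_n -> F, (map_mpoly (intr : int -> F) D).@[x] != 0.
  apply: contrapT => D0; apply: nD; apply: (vanishing_divisor_system pcharF cardF).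
  by move=> x; apply/eqP/negPn/negP => nDx; apply: D0; exists x.
pose red : {rmorphism {poly int} -> {poly %/ fp}} :=
  in_qpoly fp \o map_poly (intr : int -> 'F_p).
have red_surj y : exists b, red b = y.
  have [b Db _] := lift_poly_Fp (y : {poly 'F_p}); exists b.
  by rewrite /red /= Db; apply: val_inj; apply: in_qpoly_small (size_mk_monic y).
have [b Db] := choice (fun i => red_surj (x i)).
set Dpol := (map_mpoly (intr : int -> {poly int}) D).@[b].
have nfD : ~~ (fp %| map_poly intr Dpol).
  apply: contra nDx => fD; have red0 : red Dpol = 0.
    apply: val_inj; rewrite /= (mk_monicE hI) -Pdiv.IdomainMonic.modpE //.
    exact/eqP.
  rewrite -(meval_eq _ Db); apply/eqP; rewrite -[RHS]red0.
  exact/esym/(rmorph_meval_int red).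
have [u [v [w Duvw]]] : exists u v w : {poly int}, u * f + v * Dpol = 1 + p%:R * w.
  apply: bezout_mod_prime_poly => //.
  by rewrite irreducible_poly_coprime.
have zeta_int : zeta \in integral_elt (L := G) by apply/asboolP; exists f.
pose z := RingOfIntegers zeta_int.
pose ev : {rmorphism {poly int} -> ringOfIntegers G} :=
  horner_eval z \o map_poly (intr : int -> ringOfIntegers G).
have ev_f : ev f = 0.
  apply: val_inj; rewrite rmorph0 -(eqP f_zeta).
  rewrite -[LHS]/(val (map_poly intr f).[z]) -horner_map -map_poly_comp.
  congr _.[_].
  by apply: eq_map_poly => c; apply: (rmorph_int (\val : ringOfIntegers G -> G)).
exists (fun i => ev (b i)) => P Pp; apply/negP; rewrite -rmorph_meval_int -/Dpol => PD.
have := idealr1 P; rewrite -[1](rmorph1 ev) -(addrK (p%:R * w) 1) -Duvw.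
rewrite rmorphB rmorphD !rmorphM rmorph_nat ev_f mulr0 add0r => /negP; apply.
by apply: rpredB; [apply: idealMr | rewrite mulrC; apply: idealMr].
Qed.

(** A rational factor of f is proportional to an integral factor; its leading
    coefficient is a unit since f is monic, so reduction modulo p preserves its
    degree. *)
Lemma irreducible_rat_of_Fp (p : nat) (f : {poly int}) : prime p ->
    f \is monic -> irreducible_poly (map_poly (intr : int -> 'F_p) f) ->
  irreducible_poly (map_poly (intr : int -> rat) f).
Proof.
move=> p_pr f_monic [size_fp irr_fp].
have size_Fp (g : {poly int}) : lead_coef g \is a GRing.unit ->
    size (map_poly (intr : int -> 'F_p) g) = size g.
  move=> Ug; rewrite size_map_poly_id0 //.
  by rewrite -unitfE rmorph_unit.
have size_f : size (map_poly (intr : int -> rat) f) = size f.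
  by rewrite size_map_inj_poly //; apply: intr_inj.
split=> [|q size_q q_dvd].
  by rewrite size_f -size_Fp ?(eqP f_monic).
have [q1 [a nz_a Dq] [r Df]] := dvdpP_rat_int q_dvd.
have Uqr : lead_coef q1 * lead_coef r = 1.
  by rewrite -lead_coefM -Df (eqP f_monic).
have Uq : lead_coef q1 \is a GRing.unit by apply/unitrPr; exists (lead_coef r).
have size_q1 : size q1 = size q.
  by rewrite Dq size_scale // size_map_inj_poly //; apply: intr_inj.
have := irr_fp (map_poly intr q1).
rewrite size_Fp // size_q1 Df rmorphM dvdp_mulIl => /(_ size_q isT)/eqp_size.
rewrite -rmorphM -Df !size_Fp ?(eqP f_monic) // size_q1 => eq_size.
by rewrite -dvdp_size_eqp // size_f eq_size.
Qed.

Lemma map_poly_int_in_alg (G : fieldExtType rat) (f : {poly int}) :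
  map_poly (in_alg G) (map_poly intr f) = map_poly intr f.
Proof. by rewrite -map_poly_comp; apply: eq_map_poly => c /=; rewrite scaler_int. Qed.

Lemma degree_of_irreducible (f : {poly int}) (G : fieldExtType rat) (zeta : G) :
    irreducible_poly (map_poly (intr : int -> rat) f) ->
    root (map_poly (intr : int -> G) f) zeta -> <<1; zeta>>%VS = {: G}%VS ->
  \dim {: G} = (size f).-1.
Proof.
move=> [size_f irr_f] f_zeta defG.
have /polyOver1P[r Dr] := minPolyOver 1 zeta.
have r_dvd : r %| map_poly intr f.
  rewrite -(dvdp_map (in_alg G)) -Dr minPoly_dvdp ?alg_polyOver //.
  by rewrite map_poly_int_in_alg.
have size_r : size r = (adjoin_degree 1 zeta).+1.
  by rewrite -size_minPoly Dr size_map_poly.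
have size_r1 : size r != 1%N.
  by rewrite size_r.
have /eqp_size := irr_f r size_r1 r_dvd.
rewrite size_r size_map_inj_poly //; last exact: intr_inj.
by rewrite -defG dim_Fadjoin dimv1 muln1 => <-.
Qed.

(** The minimal polynomial over F_p of a generator of the multiplicative group
    of the field with p^k elements has degree k; only its part below X^k is
    lifted to Z, so that the lift is monic. *)
Lemma exists_irreducible_Fp (p k : nat) : prime p -> (0 < k)%N ->
  exists f : {poly int}, [/\ f \is monic, size f = k.+1 &
    irreducible_poly (map_poly (intr : int -> 'F_p) f)].
Proof.
move=> p_pr k_gt0; have [F pF cardF] := pPrimePowerField p_pr k_gt0.
pose L : fieldExtType 'F_p := pPrimeCharType pF.
have dimL : \dim {: L} = k.
  by rewrite [LHS](pprimeChar_dimf pF) cardF pfactorK.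
have /cyclicP[x Dx] := field_unit_group_cyclic [set: {unit F}].
pose z : L := val x.
have defL : <<1; z>>%VS = {: L}%VS.
  apply/eqP; rewrite eqEsubv subvf; apply/subvP => y _.
  have [->|nzy] := eqVneq y 0; first exact: mem0v.
  have Uy : (y : F) \is a GRing.unit by rewrite unitfE.
  have : FinRing.unit F Uy \in <[x]>%g by rewrite -Dx inE.
  case/cycleP => i /(congr1 val) /= ->; rewrite FinRing.val_unitX.
  exact/rpredX/memv_adjoin.
have /polyOver1P[r Dr] := minPolyOver 1 z.
have size_r : size r = k.+1.
  rewrite -(size_map_poly (in_alg L)) -Dr size_minPoly; congr _.+1.
  by rewrite -dimL -defL dim_Fadjoin dimv1 muln1.
have r_monic : r \is monic by rewrite -(map_monic (in_alg L)) -Dr monic_minPoly.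
have irr_r : irreducible_poly r.
  split=> [|q size_q q_dvd]; first by rewrite size_r.
  have : map_poly (in_alg L) q %| minPoly 1 z by rewrite Dr dvdp_map.
  move/(minPoly_irr (alg_polyOver 1 q)); rewrite Dr -(rmorph1 (map_poly (in_alg L))).
  by rewrite !eqp_map -[q %= 1]size_poly_eq1 (negPf size_q) orbF.
have [h Dh size_h] := lift_poly_Fp (r - 'X^k).
have lt_h : (size h < size ('X^k : {poly int}))%N.
  rewrite size_h size_polyXn ltnS; apply/leq_sizeP => i.
  rewrite leq_eqVlt coefB coefXn => /predU1P[<-|lt_ki].
    by rewrite eqxx -[k]/(k.+1.-1) -size_r -lead_coefE (eqP r_monic) subrr.
  by rewrite (gtn_eqF lt_ki) subr0 nth_default // size_r.
exists ('X^k + h); split.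
- by rewrite monicE lead_coefDl // lead_coefXn.
- by rewrite size_polyDl // size_polyXn.
by rewrite rmorphD /= map_polyXn Dh addrC subrK.
Qed.

(** * The smallest degree of a supplementary domain *)

Theorem mainTheorem17 (K : fieldExtType rat) (n : nat) (dimK : \dim {: K} = n)
    (xi : 'I_n -> ringOfIntegers K) (xi_basis : integral_basis xi)
    (sigma : 'I_n -> {rmorphism K -> algC})
    (sigma_distinct : forall i j, sigma i =1 sigma j -> i = j)
    (Delta : {mpoly int[n]}) (DeltaP : is_primitive_form xi sigma Delta)
    (p : nat) (p_prime : prime p)
    (k : nat) (k_gt0 : (0 < k)%N)
    (k_notin : ~ contains_divisor_system p k Delta)
    (k_first : forall j : nat, (0 < j < k)%N -> contains_divisor_system p j Delta) :
  [/\ exists2 G : fieldExtType rat,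
        supplementary_domain Delta p G & \dim {: G} = k,
      forall G : fieldExtType rat,
        supplementary_domain Delta p G -> (k <= \dim {: G})%N
    & forall f : {poly int}, f \is monic -> size f = k.+1 ->
        irreducible_poly (map_poly (intr : int -> 'F_p) f) ->
        forall (G : fieldExtType rat) (zeta : G),
          root (map_poly (intr : int -> G) f) zeta ->
          <<1; zeta>>%VS = {: G}%VS ->
          supplementary_domain Delta p G /\ \dim {: G} = k].
Proof.
have suppl f : f \is monic -> size f = k.+1 ->
    irreducible_poly (map_poly (intr : int -> 'F_p) f) ->
    forall (G : fieldExtType rat) (zeta : G),
      root (map_poly (intr : int -> G) f) zeta ->
      <<1; zeta>>%VS = {: G}%VS ->
      supplementary_domain Delta p G /\ \dim {: G} = k.
  move=> f_monic size_f irr_f G zeta f_zeta defG; split.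
    exact: (supplementary_domain_of_irreducible p_prime k_notin f_monic size_f
              irr_f f_zeta).
  rewrite (degree_of_irreducible _ f_zeta defG) ?size_f //.
  exact: (irreducible_rat_of_Fp p_prime f_monic irr_f).
split=> [|G|//]; last exact: supplementary_domain_degree_ge.
have [f [f_monic size_f irr_f]] := exists_irreducible_Fp p_prime k_gt0.
have irr_fQ := irreducible_rat_of_Fp p_prime f_monic irr_f.
have [G _ [zeta f_zeta defG]] := irredp_FAdjoin irr_fQ.
rewrite map_poly_int_in_alg in f_zeta.
by have [] := suppl f f_monic size_f irr_f G zeta f_zeta defG; exists G.
Qed.
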